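(* Let $m \geq 1$ and $n\ge 3$ be integers. If $n \geq 3$ is odd, then \[\mathrm{ParseWords}(\mathrm{LeftTurnTree}(m, n), \mathrm{RightTurnTree}(1, m + n - 1)) = \{0\, 0\, 1^{n-3}\, 2\, 0^m,\; 0\, 2\, 1^{n-3}\, 0\, 0^m\},\] and if $n \geq 4$ is even, then \[\mathrm{ParseWords}(\mathrm{LeftTurnTree}(m, n), \mathrm{RightTurnTree}(1, m + n - 1)) = \{0\, 2\, 1^{n-3}\, 2\, 0^m,\; 0\, 0\, 1^{n-3}\, 0\, 0^m\}.\] (Sets of equivalence classes are written by listing one representative of each class; exponents denote repeated concatenation.)
   Context: A binary tree is a rooted ordered tree in which each vertex has either $0$ or $2$ children; its leaves are ordered left to right. Let $G$ be the context-free grammar with start symbols $0,1,2$ and rules $0\to 12$, $0\to 21$, $1\to 02$, $1\to 20$, $2\to 01$, $2\to 10$. An $n$-leaf binary tree $T$ parses a word $w$ of length $n$ on $\{0,1,2\}$ if there is a labeling of the vertices of $T$ by $0,1,2$ such that the leaves, from left to right, are labeled with the letters of $w$, and at every internal vertex the label of the vertex together with the labels of its left and right children form a rule of $G$ (i.e. the three labels are pairwise distinct). If $T$ parses $w$, it also parses every word obtained from $w$ by permuting the alphabet $\{0,1,2\}$. For $n$-leaf binary trees $T_1,T_2$, $\mathrm{ParseWords}(T_1,T_2)$ denotes the set of equivalence classes (under permutations of the alphabet $\{0,1,2\}$) of words parsed by both $T_1$ and $T_2$; it is written by listing one representative of each class. The level of a vertex is its distance from the root. A path tree is a binary tree with at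 most two vertices on each level. For $N\ge 2$, $N$-leaf path trees correspond bijectively to words $x_1\cdots x_{N-2}$ on $\{l,r\}$: $x_j=l$ (resp. $x_j=r$) means that, of the two vertices on level $j$, the left (resp. right) one has children. $\mathrm{LeftTurnTree}(m,n)$ is the $(m+n)$-leaf path tree corresponding to $l^m r^{n-2}$, and $\mathrm{RightTurnTree}(m,n)$ is the $(m+n)$-leaf path tree corresponding to $r^m l^{n-2}$. *)

(* Defs.v *)
From mathcomp Require Import all_boot all_order all_fingroup all_algebra.
From mathcomp Require Import boolp classical_sets.

Set Implicit Arguments.
Unset Strict Implicit.
Unset Printing Implicit Defensive.

Import GRing.Theory.

Local Open Scope ring_scope.
Local Open Scope classical_set_scope.

Inductive bintree := Leaf | Node of bintree & bintree.

Fixpoint nleaves (T : bintree) : nat :=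
  if T is Node T1 T2 then (nleaves T1 + nleaves T2)%N else 1%N.

(* The subtrees hanging from the vertices on level k, from left to right. *)
Fixpoint level (k : nat) (T : bintree) : seq bintree :=
  match k, T with
  | 0%N, _ => [:: T]
  | k'.+1, Leaf => [::]
  | k'.+1, Node T1 T2 => level k' T1 ++ level k' T2
  end.

Definition is_path_tree (T : bintree) : Prop :=
  forall k : nat, (size (level k T) <= 2)%N.

Inductive turn := TurnL | TurnR.

(* The path tree of a word x_1 ... x_(N-2).  The empty word gives the tree with
   two leaves; x_1 tells which child of the root has children, and the rest of
   the word describes the subtree at that child. *)
Fixpoint path_tree (x : seq turn) : bintree :=
  match x with
  | [::] => Node Leaf Leaf
  | TurnL :: x' => Node (path_tree x') Leaf
  | TurnR :: x' => Node Leaf (path_tree x')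
  end.

Definition LeftTurnTree (m n : nat) : bintree :=
  path_tree (nseq m TurnL ++ nseq (n - 2) TurnR).

Definition RightTurnTree (m n : nat) : bintree :=
  path_tree (nseq m TurnR ++ nseq (n - 2) TurnL).

(* In ring_scope, the letters of the alphabet are 0, 1 and 2 = 1 + 1. *)
Definition letter : Type := 'I_3.
Definition word : Type := seq letter.

(* (a, b, c) stands for the rule a -> b c. *)
Definition rules : seq ('I_3 * 'I_3 * 'I_3) :=
  [:: (0, 1, 2); (0, 2, 1); (1, 0, 2); (1, 2, 0); (2, 0, 1); (2, 1, 0)].

Inductive labeling :=
  | LLeaf of letter
  | LNode of letter & labeling & labeling.

(* The tree whose vertices are being labeled. *)
Fixpoint shape (D : labeling) : bintree :=
  if D is LNode _ D1 D2 then Node (shape D1) (shape D2) else Leaf.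

Definition root_label (D : labeling) : letter :=
  match D with LLeaf a => a | LNode a _ _ => a end.

Fixpoint leaf_word (D : labeling) : word :=
  match D with
  | LLeaf a => [:: a]
  | LNode _ D1 D2 => leaf_word D1 ++ leaf_word D2
  end.

Fixpoint follows_rules (D : labeling) : bool :=
  if D is LNode a D1 D2 then
    [&& (a, root_label D1, root_label D2) \in rules,
        follows_rules D1 & follows_rules D2]
  else true.

Definition parses (T : bintree) (w : word) : Prop :=
  exists D : labeling, [/\ shape D = T, leaf_word D = w & follows_rules D].

Definition word_class (w : word) : set word :=
  [set v | exists s : 'S_3, v = [seq s a | a <- w]].

Definition ParseWords (T1 T2 : bintree) : set (set word) :=
  [set word_class w | w in [set w : word | parses T1 w /\ parses T2 w]].

Lemma rulesE (a b c : 'I_3) :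
  ((a, b, c) \in rules) = [&& a != b, a != c & b != c].
Proof.
by case: a => [[|[|[|a]]] ?] //; case: b => [[|[|[|b]]] ?] //;
   case: c => [[|[|[|c]]] ?].
Qed.

Lemma word_class_eq (w v : word) :
  word_class w = word_class v <-> exists s : 'S_3, v = [seq s a | a <- w].
Proof.
split=> [wv|[s ->]].
  have : word_class v v by exists 1%g; rewrite map_id_in // => a _; rewrite perm1.
  by rewrite -wv.
apply/seteqP; split=> u [t ->].
  exists (s^-1 * t)%g; rewrite -map_comp; apply: eq_map => a.
  by rewrite /= permM permK.
by exists (s * t)%g; rewrite -map_comp; apply: eq_map => a; rewrite /= permM.
Qed.

Lemma nleaves_gt0 (T : bintree) : (0 < nleaves T)%N.
Proof. by elim: T => //= T1 IH1 T2 _; rewrite addn_gt0 IH1. Qed.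

Lemma nleaves_path_tree (x : seq turn) : nleaves (path_tree x) = (size x).+2.
Proof. by elim: x => [|[] x IHx] //=; rewrite IHx ?addn1. Qed.

Lemma nleaves_LeftTurnTree (m n : nat) :
  (2 <= n)%N -> nleaves (LeftTurnTree m n) = (m + n)%N.
Proof.
move=> n2; rewrite nleaves_path_tree size_cat !size_nseq.
by rewrite -[in RHS](subnK n2) addnA addn2.
Qed.

Lemma nleaves_RightTurnTree (m n : nat) :
  (2 <= n)%N -> nleaves (RightTurnTree m n) = (m + n)%N.
Proof.
move=> n2; rewrite nleaves_path_tree size_cat !size_nseq.
by rewrite -[in RHS](subnK n2) addnA addn2.
Qed.

(* On level j + 1 there are two vertices, and the letter x_(j+1) (of index j in
   x) tells which of them has children. *)
Lemma level_path_tree (x : seq turn) (j : nat) : (j < size x)%N ->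
  level j.+1 (path_tree x) =
  if nth TurnL x j is TurnL then [:: path_tree (drop j.+1 x); Leaf]
  else [:: Leaf; path_tree (drop j.+1 x)].
Proof.
elim: x j => [|a x IHx] [|j] //= lt_jx; first by case: a; rewrite /= drop0.
by case: a; rewrite -(IHx j lt_jx) ?cats0.
Qed.

Lemma is_path_treeP (T : bintree) : (2 <= nleaves T)%N ->
  is_path_tree T <-> exists! x : seq turn, path_tree x = T.
Proof.
have inj x y : path_tree y = path_tree x -> x = y.
  elim: x y => [|[] x IHx] [|[] y] //=.
  - by case: y => [|[] ?].
  - by case: y => [|[] ?].
  - by case: x {IHx} => [|[] ?].
  - by case=> /IHx ->.
  - by case=> e; case: x {IHx} e => [|[] ?].
  - by case: x {IHx} => [|[] ?].
  - by case=> e; case: y e => [|[] ?].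
  - by case=> /IHx ->.
move=> T2; split=> [Tp|[x [<- _]]].
  suff [x xT]: exists x, path_tree x = T.
    by exists x; split=> // y; rewrite -xT => /inj.
  elim: T T2 Tp => // T1 IH1 T2' IH2 _ Tp.
  case: T1 T2' IH1 IH2 Tp => [|A B] [|C D] IH1 IH2 Tp.
  - by exists [::].
  - have [||x <-] := IH2; last by exists (TurnR :: x).
      by rewrite (leq_add (nleaves_gt0 C) (nleaves_gt0 D)).
    by move=> k; apply: leq_trans (Tp k.+1); rewrite /= size_cat leq_addl.
  - have [||x <-] := IH1; last by exists (TurnL :: x).
      by rewrite (leq_add (nleaves_gt0 A) (nleaves_gt0 B)).
    by move=> k; apply: leq_trans (Tp k.+1); rewrite /= size_cat leq_addr.
  - by have := Tp 2%N.
move=> {T2} k; elim: x k => [|a x IHx] [|k] //.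
  by case: k => [|[]].
by case: k => [|k]; case: a => //; have := IHx k.+1; rewrite /= ?cats0.
Qed.

(* Main.v *)
(* Let x . y = -(x + y) mod 3; for distinct letters this is the third letter.
   A word on a left (right) comb is parsed by bracketing it to the left (right)
   as a product in which no letter is multiplied by itself.  A word bracketed
   both ways must be x p ... p y with x, y <> p, and both values are p: if the
   left bracketing has reached c and the remaining letters z w have value d
   from the right, then p = c . d, and z differs from both c and d, so z = p.
   Writing a word as a u v with |v| = m, the right turn tree brackets a (u v)
   with u v to the left, and the left turn tree brackets a u to the right and
   then v to the left.  So u is bracketed both ways, with common value p <> a,
   and the letters of v are read from the states p and a . p at once; these are
   exchanged at each step, so that every letter of v is a. *)
Require Import Defs.
From mathcomp Require Import all_boot all_order all_fingroup all_algebra.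
From mathcomp Require Import boolp classical_sets.

Set Implicit Arguments.
Unset Strict Implicit.

Import GRing.Theory.

Local Open Scope ring_scope.
Local Open Scope classical_set_scope.

(** * Arithmetic of the third letter *)

Definition third (a b : letter) : letter := - (a + b).

Ltac case_letter a := case: a => [[|[|[|?]]] ?] //.

Lemma mem_rules (a b c : letter) :
  ((a, b, c) \in rules) = (b != c) && (a == third b c).
Proof. by rewrite rulesE; case_letter a; case_letter b; case_letter c. Qed.

Lemma thirdC (a b : letter) : third a b = third b a.
Proof. by rewrite /third addrC. Qed.

Lemma thirdK (a b : letter) : third a (third a b) = b.
Proof. by rewrite /third opprD opprK addrA addNr add0r. Qed.

Lemma third_neql (a b : letter) : (third a b != a) = (a != b).
Proof. by case_letter a; case_letter b. Qed.

Lemma eq_third (a b c : letter) : a != b -> c != a -> c != b -> c = third a b.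
Proof.
by move=> ab ca cb; apply/eqP; move: ab ca cb;
   case_letter a; case_letter b; case_letter c.
Qed.

(* [lok s w] and [rok x w]: bracketing [s :: w] to the left, resp. [x :: w] to
   the right, never multiplies a letter by itself. *)
Fixpoint lok (s : letter) (w : word) : bool :=
  if w is x :: w' then (s != x) && lok (third s x) w' else true.

Fixpoint rval (x : letter) (w : word) : letter :=
  if w is y :: w' then third x (rval y w') else x.

Fixpoint rok (x : letter) (w : word) : bool :=
  if w is y :: w' then (x != rval y w') && rok y w' else true.

Notation lval := (foldl third).

Lemma lok_cat (s : letter) (u v : word) :
  lok s (u ++ v) = lok s u && lok (lval s u) v.
Proof. by elim: u s => //= x u IHu s; rewrite IHu andbA. Qed.

(** * Parsing by combs *)

(** The root label is exposed because the rule at the parent vertex refers to it. *)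
Definition derives (T : bintree) (a : letter) (w : word) : Prop :=
  exists D : labeling,
    [/\ Defs.shape D = T, root_label D = a, leaf_word D = w & follows_rules D].

Lemma parses_derives (T : bintree) (w : word) :
  parses T w <-> exists a, derives T a w.
Proof.
split=> [[D [? ? ?]]|[a [D [? ? ? ?]]]]; last by exists D.
by exists (root_label D), D.
Qed.

Lemma derives_Leaf (a : letter) (w : word) : derives Leaf a w <-> w = [:: a].
Proof.
split=> [[[b|r D1 D2] [] //= _ <- <-]|->] //.
by exists (LLeaf a).
Qed.

Lemma derives_Node (T1 T2 : bintree) (a : letter) (w : word) :
  derives (Node T1 T2) a w <->
  exists b c w1 w2, [/\ derives T1 b w1, derives T2 c w2, w = w1 ++ w2,
                        b != c & a = third b c].
Proof.
split.
  move=> [[b|r D1 D2] [] //= [sD1 sD2] -> <-].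
  rewrite mem_rules => /and3P[/andP[bc /eqP ->] f1 f2].
  exists (root_label D1), (root_label D2), (leaf_word D1), (leaf_word D2).
  by split=> //; [exists D1 | exists D2].
move=> [b [c [w1 [w2 [[D1 [s1 r1 l1 f1]] [D2 [s2 r2 l2 f2]] -> bc ->]]]]].
exists (LNode (third b c) D1 D2); split=> //=; rewrite ?s1 ?s2 ?l1 ?l2 //.
by rewrite mem_rules r1 r2 bc eqxx f1.
Qed.

(** The subtree at the bottom of the left turns supplies the starting state [q]. The right child of
    the root is the last leaf, so the induction on [m] removes letters at the end of [v]. *)
Lemma derives_lcomb (m : nat) (x : seq turn) (a : letter) (w : word) :
  derives (path_tree (nseq m TurnL ++ x)) a w <->
  exists q u v, [/\ derives (path_tree x) q u, w = u ++ v, size v = m,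
                    lok q v & a = lval q v].
Proof.
elim: m a w => [|m IHm] a w /=.
  split=> [dw|[q [u [[|c v] [dw -> //= _ _ ->]]]]]; last by rewrite cats0.
  by exists a, w, [::]; rewrite cats0.
split.
  move=> /derives_Node[b [c [w1 [w2 [/IHm[q [u [v [du -> sv ok ->]]]]]]]]].
  move=> /derives_Leaf -> -> bc ->; exists q, u, (rcons v c).
  by rewrite -cats1 lok_cat foldl_cat catA /= ok bc size_cat sv addn1.
move=> [q [u [v [du ->]]]]; case/lastP: v => // v c.
rewrite size_rcons -cats1 lok_cat foldl_cat /= andbT => -[sv] /andP[ok bc] ->.
apply/derives_Node; exists (lval q v), c, (u ++ v), [:: c].
split=> //; [|exact/derives_Leaf|by rewrite catA].
by apply/IHm; exists q, u, v.
Qed.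

Lemma derives_cherry (a : letter) (w : word) :
  derives (path_tree [::]) a w <->
  exists b c, [/\ w = [:: b; c], b != c & a = third b c].
Proof.
split=> [/derives_Node[b [c [? [? [/derives_Leaf -> /derives_Leaf -> ? ? ?]]]]]|].
  by exists b, c.
move=> [b [c [-> bc ->]]]; apply/derives_Node; exists b, c, [:: b], [:: c].
by split=> //; exact/derives_Leaf.
Qed.

Lemma derives_lcomb0 (m : nat) (a : letter) (w : word) :
  derives (path_tree (nseq m TurnL)) a w <->
  exists x v, [/\ w = x :: v, size v = m.+1, lok x v & a = lval x v].
Proof.
rewrite -[nseq m TurnL]cats0; split.
  move=> /derives_lcomb[q [u [v [/derives_cherry[b [c [-> bc ->]]] -> sv ok ->]]]].
  by exists b, (c :: v); rewrite /= bc sv.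
move=> [x [[|y v] [-> // [sv] /= /andP[xy ok] ->]]].
apply/derives_lcomb; exists (third x y), [:: x; y], v; split=> //.
by apply/derives_cherry; exists x, y.
Qed.

Lemma derives_rcomb (m : nat) (a : letter) (w : word) :
  derives (path_tree (nseq m TurnR)) a w <->
  exists x v, [/\ w = x :: v, size v = m.+1, rok x v & a = rval x v].
Proof.
elim: m a w => [|m IHm] a w.
  split=> [/derives_cherry[b [c [-> bc ->]]]|].
    by exists b, [:: c]; rewrite /= bc.
  move=> [x [[|y [|z v]] [-> //= _ /andP[xy _] ->]]].
  by apply/derives_cherry; exists x, y.
split.
  move=> /derives_Node[b [c [w1 [w2 [/derives_Leaf ->]]]]].
  move=> /IHm[x [v [-> sv ok ->]]] -> bc ->.
  by exists b, (x :: v); rewrite /= bc sv.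
move=> [x [[|y v] [-> // [sv] /= /andP[xy ok] ->]]].
apply/derives_Node; exists x, (rval y v), [:: x], (y :: v); split=> //.
  exact/derives_Leaf.
by apply/IHm; exists y, v.
Qed.

Lemma parses_LeftTurnTree (m k : nat) (w : word) :
  parses (LeftTurnTree m k.+3) w <->
  exists a x u v, [/\ w = a :: x :: u ++ v, size u = k.+1, size v = m,
    rok x u & (a != rval x u) && lok (third a (rval x u)) v].
Proof.
rewrite parses_derives /LeftTurnTree !subSS subn0; split.
  move=> [b /derives_lcomb[q [u [v [/derives_rcomb[a [[|x u'] [-> // [su]]]]]]]]].
  move=> /= /andP[ax ok] -> -> sv okv _.
  by exists a, x, u', v; rewrite ax.
move=> [a [x [u [v [-> su sv ok /andP[ax okv]]]]]].
exists (lval (third a (rval x u)) v); apply/derives_lcomb.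
exists (third a (rval x u)), (a :: x :: u), v; split=> //.
by apply/derives_rcomb; exists a, (x :: u); rewrite /= ax su.
Qed.

Lemma parses_RightTurnTree1 (k : nat) (w : word) :
  parses (RightTurnTree 1 k.+2) w <->
  exists a x v, [/\ w = a :: x :: v, size v = k.+1, lok x v & a != lval x v].
Proof.
rewrite parses_derives /RightTurnTree !subSS subn0; split.
  move=> [b /derives_Node[a [c [w1 [w2 [/derives_Leaf ->]]]]]].
  by move=> /derives_lcomb0[x [v [-> sv ok ->]]] -> ac _; exists a, x, v.
move=> [a [x [v [-> sv ok ac]]]]; exists (third a (lval x v)).
apply/derives_Node; exists a, (lval x v), [:: a], (x :: v); split=> //.
  exact/derives_Leaf.
by apply/derives_lcomb0; exists x, v.
Qed.

(** * Words bracketed both ways *)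

(** For [x != p], the last letter is the one that gives [x :: pword k x p] the value [p]; it depends
    on parity since [third p] is an involution. *)
Definition pword (k : nat) (x p : letter) : word :=
  nseq k p ++ [:: if odd k then x else third x p].

Lemma size_pword (k : nat) (x p : letter) : size (pword k x p) = k.+1.
Proof. by rewrite size_cat size_nseq addn1. Qed.

Lemma pwordS (k : nat) (x p : letter) :
  pword k.+1 x p = p :: pword k (third x p) p.
Proof.
by rewrite /pword /=; case: (odd k); rewrite //= thirdC (thirdC x) thirdK.
Qed.

Lemma lcomb_rcomb (k : nat) (x : letter) (w : word) :
  size w = k.+1 -> lok x w -> rok x w ->
  x != rval x w /\ w = pword k x (rval x w).
Proof.
elim: k x w => [|k IHk] x [//|z w] [].
  case: w => // _ /= /andP[xz _] _.
  by rewrite eq_sym third_neql xz /pword /= thirdK.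
case: w => // y w [sw] /=; set d := third z _.
move=> /andP[xz okl] /andP[xd /andP[zy ok]].
have zE : z = third x d.
  by apply: eq_third; rewrite // 1?eq_sym // third_neql.
have dE : third x z = d by rewrite zE thirdK.
have yE : rval y w = x.
  by rewrite -[LHS](thirdK z) -/d {1}zE thirdC (thirdC x) thirdK.
(* Since [third x z = d], the rest [y :: w] is read to the left from [d]; prefixed by [d], it is
   again bracketed both ways, with value [third d x = z]. *)
have [] := IHk d (y :: w); rewrite /= ?sw ?yE ?(eq_sym d x) ?xd //.
  by rewrite -dE.
rewrite (thirdC d) -zE => dz wE.
by rewrite xz pwordS dE; split=> //; congr cons.
Qed.

(** Converse of [lcomb_rcomb]: reading the first [p] to the left moves the state from [x] to
    [third x p], where the induction hypothesis applies. *)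
Lemma pword_ok (k : nat) (x p : letter) : x != p ->
  [/\ lok x (pword k x p), rok x (pword k x p),
      lval x (pword k x p) = p & rval x (pword k x p) = p].
Proof.
elim: k x => [|k IHk] x xp.
  by rewrite /= thirdK eq_sym third_neql xp.
have [|okl okr lE rE] := IHk (third x p).
  by rewrite thirdC third_neql eq_sym.
rewrite pwordS.
have : size (pword k (third x p) p) = k.+1 by rewrite size_pword.
case: (pword _ _ _) okl okr lE rE => //= y w okl /andP[_ ->] -> rE _.
have yE : rval y w = x.
  by rewrite -[LHS](thirdK (third x p)) rE thirdC (thirdC x) thirdK.
rewrite yE xp okl (thirdC p) thirdK !(eq_sym _ (third _ _)) (eq_sym p).
by rewrite third_neql xp.
Qed.

(** * Words parsed by both trees *)

Lemma lok_two_states (s a : letter) (v : word) : s != a ->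
  lok s v && lok (third a s) v = (v == nseq (size v) a).
Proof.
elim: v s => //= x v IHv s sa; rewrite eqseq_cons.
have [->|xa] /= := eqVneq x a.
  rewrite sa third_neql (eq_sym a) sa (thirdC (third a s)) thirdK (thirdC s).
  rewrite andbC.
  exact: IHv.
(* A letter other than [a] equals one of the two states, which then rejects it. *)
have [|sx] //= := eqVneq s x; rewrite [x in third a s != x](@eq_third a s x).
  by rewrite eqxx andbF.
all: by rewrite // eq_sym.
Qed.

Lemma lval_nseq_neq (m : nat) (s a : letter) :
  s != a -> lval s (nseq m a) != a.
Proof.
elim: m s => //= m IHm s sa.
by apply: IHm; rewrite thirdC third_neql eq_sym.
Qed.

Definition common_word (m k : nat) (a x p : letter) : word :=
  a :: x :: pword k x p ++ nseq m a.

Lemma parses_both (m k : nat) (w : word) :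
  parses (LeftTurnTree m k.+3) w /\
    parses (RightTurnTree 1 (m + k.+3 - 1)) w <->
  exists a x p, [/\ a != p, x != p & w = common_word m k a x p].
Proof.
rewrite (_ : m + k.+3 - 1 = (m + k).+2)%N; last by rewrite !addnS subn1.
rewrite parses_LeftTurnTree parses_RightTurnTree1; split.
  move=> [[a [x [u [v [-> su sv okr /andP[ap okv]]]]]]].
  move=> [_ [_ [_ [[<- <- <-] _]]]]; rewrite lok_cat => /andP[okl okv'] _.
  have [xp uE] := lcomb_rcomb su okl okr.
  exists a, x, (rval x u); split=> //; rewrite /common_word -uE -sv.
  congr [:: _, _ & _ ++ _].
  (* The left turn tree reads [v] from [third a (rval x u)], the right turn tree from [lval x u],
     which equals [rval x u] by the form of [u]. *)
  apply/eqP; rewrite -(lok_two_states (s := rval x u)) 1?eq_sym // okv andbT.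
  by have [_ _ <- _] := pword_ok k xp; rewrite -uE.
move=> [a [x [p [ap xp ->]]]]; have pa : p != a by rewrite eq_sym.
have [okl okr lE rE] := pword_ok k xp.
have := lok_two_states (nseq m a) pa.
rewrite size_nseq eqxx => /andP[okp okq].
split.
  by exists a, x, (pword k x p), (nseq m a); rewrite size_nseq size_pword rE ap.
exists a, x, (pword k x p ++ nseq m a); split=> //.
- by rewrite size_cat size_pword size_nseq addSn addnC.
- by rewrite lok_cat okl lE.
- by rewrite foldl_cat lE eq_sym lval_nseq_neq.
Qed.

(** * Normalization by permuting the alphabet *)

Lemma perm_third (s : 'S_3) (a b : letter) :
  a != b -> s (third a b) = third (s a) (s b).
Proof.
move=> ab; have ba : b != a by rewrite eq_sym.
apply: eq_third; rewrite (inj_eq perm_inj) ?third_neql //.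
by rewrite thirdC third_neql.
Qed.

Lemma perm_of_letters (a p : letter) : a != p ->
  exists s : 'S_3, s 0 = a /\ s 1 = p.
Proof.
move=> ap; have inj : injective (fun i : letter =>
    if i == 0 then a else if i == 1 then p else third a p).
  by move=> i j; move: ap; case_letter a; case_letter p;
     case_letter i; case_letter j => _ /eqP //= _; apply/val_inj.
by exists (perm inj); rewrite !permE.
Qed.

Lemma map_pword (s : 'S_3) (k : nat) (x p : letter) :
  x != p -> [seq s a | a <- pword k x p] = pword k (s x) (s p).
Proof.
by move=> xp; rewrite map_cat map_nseq /= (fun_if s) perm_third.
Qed.

Lemma ParseWords_common (m k : nat) :
  ParseWords (LeftTurnTree m k.+3) (RightTurnTree 1 (m + k.+3 - 1)) =
  [set word_class (common_word m k 0 0 1); word_class (common_word m k 0 2 1)].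
Proof.
apply/seteqP; split=> c /=; last first.
  move=> c02; suff [x x1 ->]: exists2 x : letter,
      x != 1 & c = word_class (common_word m k 0 x 1).
    by exists (common_word m k 0 x 1) => //; apply/parses_both; exists 0, x, 1.
  by case: c02 => ->; [exists 0 | exists 2].
move=> [w /parses_both[a [x [p [ap xp ->]]]] <-].
have [s [s0 s1]] := perm_of_letters ap.
have wE (y : letter) : y != 1 -> s y = x ->
    word_class (common_word m k a x p) =
    word_class (common_word m k 0 y 1).
  move=> y1 yx; apply/esym/word_class_eq; exists s.
  by rewrite /common_word /= map_cat map_nseq map_pword // s0 s1 yx.
(* With [a] and [p] the images of 0 and 1, the letter [x != p] comes from 0 or 2, hence two
   classes. *)
have [xa|xa] := eqVneq x a; first by left; apply: wE; rewrite // s0.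
right; apply: wE => //; rewrite (_ : 2 = third 0 1); last exact/val_inj.
by rewrite perm_third // s0 s1; apply/esym/eq_third.
Qed.

Theorem theorem5 (m n : nat) (hm : (1 <= m)%N) (hn : (3 <= n)%N) :
  (odd n ->
    ParseWords (LeftTurnTree m n) (RightTurnTree 1 (m + n - 1)) =
    [set word_class ([:: 0; 0] ++ nseq (n - 3) 1 ++ [:: 2] ++ nseq m 0);
         word_class ([:: 0; 2] ++ nseq (n - 3) 1 ++ [:: 0] ++ nseq m 0)]) /\
  (~~ odd n ->
    ParseWords (LeftTurnTree m n) (RightTurnTree 1 (m + n - 1)) =
    [set word_class ([:: 0; 2] ++ nseq (n - 3) 1 ++ [:: 2] ++ nseq m 0);
         word_class ([:: 0; 0] ++ nseq (n - 3) 1 ++ [:: 0] ++ nseq m 0)]).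
Proof.
case: n hn => [|[|[|k]]] // _; rewrite ParseWords_common /common_word /pword.
have E0 : third 0 1 = 2 by apply/val_inj.
have E2 : third 2 1 = 0 by apply/val_inj.
rewrite !subSS subn0 /= !negbK E0 E2.
(* As [n] is [k.+3], odd [n] means even [k]. For even [n] the class with second letter 2 is listed
   first, hence [setUC]. *)
by split=> [/negbTE ->|->]; rewrite -!catA // setUC.
Qed.
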